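(* Let $\epsilon,\tilde\epsilon\in\mathbb{Z}_2^{n+1}$ be such that $|\epsilon|=|\tilde\epsilon|$. Then the odd Krawtchouk polynomial $\mathcal{P}_{\bar1}(\epsilon,\tilde\epsilon)$ satisfies the following recurrence relations, for every $i\in\{0,\dots,n\}$: $$\epsilon_i\,\mathcal{P}_{\bar1}(\epsilon,\tilde\epsilon)=q_0^{-1}\tilde q_i\sum_{0\le k,l\le n}q_k\,v_{k,i}v_{l,i}\,(-1)^{s_k(\tilde\epsilon-e_l)+s_l(\tilde\epsilon)}\,\tilde\epsilon_l\,\mathcal{P}_{\bar1}(\epsilon,\tilde\epsilon+e_k-e_l),$$ $$\tilde\epsilon_i\,\mathcal{P}_{\bar1}(\epsilon,\tilde\epsilon)=q_0^{-1}q_i\sum_{0\le k,l\le n}\tilde q_k\,v_{i,k}v_{i,l}\,(-1)^{s_k(\epsilon-e_l)+s_l(\epsilon)}\,\epsilon_l\,\mathcal{P}_{\bar1}(\epsilon+e_k-e_l,\tilde\epsilon).$$ Furthermore, $$\epsilon_0\,\mathcal{P}_{\bar1}(\epsilon,\tilde\epsilon)=\sum_{0\le k\le n}q_k\tilde\epsilon_k\,\mathcal{P}_{\bar1}(\epsilon,\tilde\epsilon)+\sum_{0\le k\ne l\le n}q_k(-1)^{s_k(\tilde\epsilon-e_l)+s_l(\tilde\epsilon)}\,\tilde\epsilon_l\,\mathcal{P}_{\bar1}(\epsilon,\tilde\epsilon+e_k-e_l),$$ $$\tilde\epsilon_0\,\mathcal{P}_{\bar1}(\epsilon,\tilde\epsilon)=\sum_{0\le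 k\le n}\tilde q_k\epsilon_k\,\mathcal{P}_{\bar1}(\epsilon,\tilde\epsilon)+\sum_{0\le k\ne l\le n}\tilde q_k(-1)^{s_k(\epsilon-e_l)+s_l(\epsilon)}\,\epsilon_l\,\mathcal{P}_{\bar1}(\epsilon+e_k-e_l,\tilde\epsilon).$$
   Context: Let $n\in\mathbb{Z}_{\ge0}$ and $\Lambda=(q,\tilde q,V)$ with $q,\tilde q\in\mathbb{C}^{n+1}$ and $V=(v_{i,j})_{i,j=0}^n$ a complex matrix such that $q_0=\tilde q_0\ne0$, $v_{0,j}=v_{i,0}=1$ for all $i,j$, and $QV\tilde QV^{\mathsf t}=q_0I_{n+1}$, where $Q=\mathrm{diag}(q)$, $\tilde Q=\mathrm{diag}(\tilde q)$. $\mathbb{Z}_2=\{0,1\}$, $|\epsilon|=\sum_i\epsilon_i$. Let $\xi_0,\dots,\xi_n$ be anticommuting (Grassmann) variables, $\xi_i\xi_j=-\xi_j\xi_i$, $\xi_j^2=0$; $\xi^\epsilon=\xi_0^{\epsilon_0}\cdots\xi_n^{\epsilon_n}$. For $d\le n+1$ and $\epsilon,\tilde\epsilon\in\mathbb{Z}_2^{n+1}$ with $|\epsilon|=|\tilde\epsilon|=d$, the odd Krawtchouk polynomials $\mathcal{P}_{\bar1}(\epsilon,\tilde\epsilon)=\mathcal{P}_{\bar1}(\epsilon,\tilde\epsilon;\Lambda,d)$ are defined by $$\prod_{i=0}^n\Big(\sum_{j=0}^nv_{i,j}\xi_j\Big)^{\tilde\epsilon_i}=\sum_{|\epsilon|=d}d!\,\mathcal{P}_{\bar1}(\epsilon,\tilde\epsilon)\,\xi^\epsilon,$$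 the product being taken in increasing order of $i$. Equivalently $\mathcal{P}_{\bar1}(\epsilon,\tilde\epsilon)=\frac1{d!}\sum_{|I|=|J|=d}\det A_{I,J}$ with $A=\mathrm{diag}(\tilde\epsilon)V\mathrm{diag}(\epsilon)$, where $I,J$ range over size-$d$ subsets of $\{0,\dots,n\}$ and $A_{I,J}$ is the submatrix with rows $I$, columns $J$. $e_k$ is the $k$-th standard basis vector (indices $0,\dots,n$); sums such as $\epsilon+e_k-e_l$ are computed with integer entries, and $\mathcal{P}_{\bar1}$ is set to $0$ whenever one of its arguments is not in $\mathbb{Z}_2^{n+1}=\{0,1\}^{n+1}$. $s_j(\epsilon)=\sum_{k=0}^{j-1}\epsilon_k$. *)

(* Defs.v *)
From HB Require Import structures.
From mathcomp Require Import all_boot all_order all_algebra.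
From mathcomp Require Import ring.
From mathcomp Require Import reals complex.

Set Implicit Arguments.
Unset Strict Implicit.
Unset Printing Implicit Defensive.

Import Order.TTheory GRing.Theory Num.Theory.
Local Open Scope ring_scope.

(* The Grassmann algebra over K on m anticommuting generators: an element is
   the family of its coefficients on the monomials xi_A = \prod_(i in A) xi_i
   (increasing order of i), A ranging over the subsets of 'I_m. *)
Definition grassmann (K : comNzRingType) (m : nat) : Type :=
  {ffun {set 'I_m} -> K^o}.

HB.instance Definition _ (K : comNzRingType) m :=
  GRing.Lmodule.copy (grassmann K m) {ffun {set 'I_m} -> K^o}.

Section Grassmann.
Variables (K : comNzRingType) (m : nat).
Implicit Types (A B S : {set 'I_m}) (a b c : grassmann K m) (k : K).

Definition gcoef A a : K := a A.

(* For disjoint A and B, xi_A * xi_B = (-1) ^+ inversions A B *: xi_(A :|: B),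
   and xi_A * xi_B = 0 otherwise. *)
Definition inversions A B : nat :=
  (\sum_(i in A) \sum_(j in B) (j < i))%N.

Definition gmonomial A : grassmann K m :=
  [ffun B : {set 'I_m} => (B == A)%:R].

Definition gmul a b : grassmann K m :=
  [ffun S : {set 'I_m} => \sum_(A : {set 'I_m} | A \subset S)
     (-1) ^+ inversions A (S :\: A) * gcoef A a * gcoef (S :\: A) b].

Lemma inversions0l B : inversions set0 B = 0%N.
Proof. by rewrite /inversions big_set0. Qed.

Lemma inversions0r A : inversions A set0 = 0%N.
Proof. by rewrite /inversions big1 // => i _; rewrite big_set0. Qed.

Lemma sumn_disjointU A B (F : 'I_m -> nat) : [disjoint A & B] ->
  (\sum_(i in A :|: B) F i = \sum_(i in A) F i + \sum_(i in B) F i)%N.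
Proof.
move=> dAB; rewrite (eq_bigl [predU A & B]) ?bigU // => i.
by rewrite !inE.
Qed.

Lemma inversionsUl A B S : [disjoint A & B] ->
  inversions (A :|: B) S = (inversions A S + inversions B S)%N.
Proof. exact: sumn_disjointU. Qed.

Lemma inversionsUr A B S : [disjoint A & B] ->
  inversions S (A :|: B) = (inversions S A + inversions S B)%N.
Proof.
move=> dAB; rewrite /inversions -big_split /=.
by apply: eq_bigr => i _; rewrite sumn_disjointU.
Qed.

Lemma grassmannP a b : (forall A, gcoef A a = gcoef A b) -> a = b.
Proof. by move=> eq_ab; apply/ffunP. Qed.

Lemma gcoef0 A : gcoef A 0 = 0.
Proof. by rewrite /gcoef ffunE. Qed.

Lemma gcoefD A a b : gcoef A (a + b) = gcoef A a + gcoef A b.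
Proof. by rewrite /gcoef ffunE. Qed.

Lemma gcoefZ A k a : gcoef A (k *: a) = k * gcoef A a.
Proof. by rewrite /gcoef ffunE. Qed.

Lemma gcoef_sum I (r : seq I) (P : pred I) (F : I -> grassmann K m) A :
  gcoef A (\sum_(i <- r | P i) F i) = \sum_(i <- r | P i) gcoef A (F i).
Proof. exact: (big_morph (gcoef A) (gcoefD A) (gcoef0 A)). Qed.

Lemma gcoef_gmonomial A B : gcoef B (gmonomial A) = (B == A)%:R.
Proof. by rewrite /gcoef ffunE. Qed.

Lemma gcoef_gmul S a b :
  gcoef S (gmul a b) = \sum_(A : {set 'I_m} | A \subset S)
     (-1) ^+ inversions A (S :\: A) * gcoef A a * gcoef (S :\: A) b.
Proof. by rewrite {1}/gcoef ffunE. Qed.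

Fact gmulA : associative gmul.
Proof.
move=> a b c; apply: grassmannP => S; rewrite !gcoef_gmul.
transitivity (\sum_(A : {set 'I_m} | A \subset S)
  \sum_(B : {set 'I_m} | (A \subset B) && (B \subset S))
    (-1) ^+ (inversions A (B :\: A) + inversions A (S :\: B)
             + inversions (B :\: A) (S :\: B))
    * gcoef A a * gcoef (B :\: A) b * gcoef (S :\: B) c).
  apply: eq_bigr => A AS; rewrite gcoef_gmul mulr_sumr.
  rewrite (reindex_onto (fun B => B :\: A) (fun D => A :|: D)) /=; last first.
    move=> D; rewrite subsetD => /andP [_ dDA].
    by rewrite setDUl setDv set0U; apply/setDidPl.
  apply: eq_big => B.
    apply/andP/andP => [[BS /eqP BA]|[AB BS]].
      split; first by rewrite -BA subsetUl.
      by rewrite -BA subUset AS (subset_trans BS) ?subsetDl.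
    split; first exact: setSD.
    by rewrite -{2}(setID B A) (setIidPr AB).
  move=> /andP [BS /eqP BA].
  have AB : A \subset B by rewrite -BA subsetUl.
  have -> : S :\: A :\: (B :\: A) = S :\: B by rewrite setDDl BA.
  have BS' : B \subset S.
    by rewrite -BA subUset AS (subset_trans BS) ?subsetDl.
  have -> : S :\: A = (B :\: A) :|: (S :\: B).
    apply/setP => x; rewrite !inE.
    have := subsetP AB x; have := subsetP BS' x.
    by case: (x \in A) => h1 h2; case: (x \in B) h1 h2 => h1 h2 //=;
      rewrite ?(h2 isT) ?h1 //; have := h2 isT.
  rewrite inversionsUr; last first.
    by rewrite -setI_eq0; apply/eqP/setP => x; rewrite !inE;
      case: (x \in B); rewrite ?andbF.
  by rewrite !exprD; ring.
rewrite (exchange_big_dep (fun B => B \subset S)) /=; last first.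
  by move=> A B _ /andP [].
apply: eq_bigr => B BS; rewrite gcoef_gmul mulr_sumr mulr_suml.
apply: eq_big => A.
  by rewrite BS andbT; case: (boolP (A \subset B)) => // AB;
    rewrite ?andbF // (subset_trans AB BS).
move=> /and3P [_ AB _].
have -> : inversions B (S :\: B)
    = (inversions A (S :\: B) + inversions (B :\: A) (S :\: B))%N.
  rewrite -inversionsUl.
    by congr inversions; rewrite -{1}(setID B A) (setIidPr AB).
  rewrite -setI_eq0; apply/eqP/setP => x; rewrite !inE.
  by case: (x \in A); rewrite ?andbF.
by rewrite !exprD; ring.
Qed.

Fact gmul1g : left_id (gmonomial set0) gmul.
Proof.
move=> a; apply: grassmannP => S; rewrite gcoef_gmul.
rewrite (bigD1 set0) ?sub0set //= big1 ?addr0.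
  by rewrite inversions0l gcoef_gmonomial eqxx setD0 !mul1r.
by move=> A /andP [_ /negPf A0]; rewrite gcoef_gmonomial A0 mulr0 mul0r.
Qed.

Fact gmulg1 : right_id (gmonomial set0) gmul.
Proof.
move=> a; apply: grassmannP => S; rewrite gcoef_gmul.
rewrite (bigD1 S) //= big1 ?addr0.
  by rewrite setDv inversions0r gcoef_gmonomial eqxx !(mul1r, mulr1).
move=> A /andP [AS /negPf nAS]; rewrite gcoef_gmonomial setD_eq0.
case: (boolP (S \subset A)) => SA; last by rewrite mulr0.
by rewrite eqEsubset AS SA in nAS.
Qed.

Fact gmulDl : left_distributive gmul +%R.
Proof.
move=> a b c; apply: grassmannP => S; rewrite gcoefD !gcoef_gmul -big_split.
by apply: eq_bigr => A _; rewrite gcoefD mulrDr mulrDl.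
Qed.

Fact gmulDr : right_distributive gmul +%R.
Proof.
move=> a b c; apply: grassmannP => S; rewrite gcoefD !gcoef_gmul -big_split.
by apply: eq_bigr => A _; rewrite gcoefD mulrDr.
Qed.

Fact gone_neq0 : gmonomial set0 != 0.
Proof.
apply/eqP => /(congr1 (gcoef set0)) /eqP.
by rewrite gcoef_gmonomial gcoef0 eqxx oner_eq0.
Qed.

HB.instance Definition _ := GRing.Zmodule_isNzRing.Build (grassmann K m)
  gmulA gmul1g gmulg1 gmulDl gmulDr gone_neq0.

Fact gscalerAl k a b : k *: (a * b) = k *: a * b.
Proof.
apply: grassmannP => S; rewrite gcoefZ !gcoef_gmul mulr_sumr.
by apply: eq_bigr => A _; rewrite gcoefZ; ring.
Qed.

HB.instance Definition _ :=
  GRing.Lmodule_isLalgebra.Build K (grassmann K m) gscalerAl.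

Fact gscalerAr k a b : k *: (a * b) = a * (k *: b).
Proof.
apply: grassmannP => S; rewrite gcoefZ !gcoef_gmul mulr_sumr.
by apply: eq_bigr => A _; rewrite gcoefZ; ring.
Qed.

HB.instance Definition _ :=
  GRing.Lalgebra_isAlgebra.Build K (grassmann K m) gscalerAr.

Definition xi (i : 'I_m) : grassmann K m := gmonomial [set i].

Lemma gcoefM S a b :
  gcoef S (a * b) = \sum_(A : {set 'I_m} | A \subset S)
     (-1) ^+ inversions A (S :\: A) * gcoef A a * gcoef (S :\: A) b.
Proof. exact: gcoef_gmul. Qed.

Lemma gmonomialM A B : [disjoint A & B] ->
  gmonomial A * gmonomial B = (-1) ^+ inversions A B *: gmonomial (A :|: B).
Proof.
move=> dAB; have BE : (A :|: B) :\: A = B.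
  by rewrite setDUl setDv set0U; apply/setDidPl; rewrite disjoint_sym.
apply: grassmannP => S; rewrite gcoefM gcoefZ gcoef_gmonomial.
case: eqP => [->|nS].
  rewrite (bigD1 A) ?subsetUl //= big1 ?addr0.
    by rewrite !gcoef_gmonomial BE !eqxx !mulr1.
  by move=> C /andP [_ /negPf nC]; rewrite gcoef_gmonomial nC mulr0 mul0r.
rewrite mulr0 big1 // => C CS; rewrite !gcoef_gmonomial.
case: eqP => [CA|_]; last by rewrite mulr0 mul0r.
case: eqP => [SB|_]; last by rewrite mulr0.
by case: nS; rewrite -SB CA -{1}(setID S A) (setIidPr _) // -CA.
Qed.

Lemma gmonomialM0 A B : ~~ [disjoint A & B] -> gmonomial A * gmonomial B = 0.
Proof.
move=> dAB; apply: grassmannP => S; rewrite gcoefM gcoef0.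
rewrite big1 // => C CS; rewrite !gcoef_gmonomial.
case: eqP => [CA|_]; last by rewrite mulr0 mul0r.
case: eqP => [SB|_]; last by rewrite mulr0.
case/negP: dAB; rewrite -SB CA -setI_eq0; apply/eqP/setP => x; rewrite !inE.
by case: (x \in A).
Qed.

Lemma inversions11 (i j : 'I_m) : inversions [set i] [set j] = (j < i)%N.
Proof. by rewrite /inversions !big_set1. Qed.

Lemma xi_anticomm i j : xi i * xi j = - (xi j * xi i).
Proof.
have [->|nij] := eqVneq i j.
  by rewrite /xi gmonomialM0 ?oppr0 // disjoints1 set11.
rewrite /xi !gmonomialM ?disjoints1 ?inE ?(eq_sym j) // !inversions11 setUC.
rewrite -scaleNr; congr (_ *: _).
by case: ltngtP nij => //= [_ _|/val_inj ->]; rewrite ?opprK ?eqxx.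
Qed.

Lemma xi_sqr0 i : xi i ^+ 2 = 0.
Proof. by rewrite expr2 /xi gmonomialM0 // disjoints1 set11. Qed.

Lemma gmonomialE A : gmonomial A = \prod_(i < m) xi i ^+ (i \in A).
Proof.
transitivity (\prod_(i <- enum 'I_m) xi i ^+ (i \in A)); last first.
  by rewrite enumT.
transitivity (gmonomial [set i in A | i \in enum 'I_m]).
  by congr gmonomial; apply/setP => i; rewrite !inE mem_enum andbT.
have : sorted ltn (map val (enum 'I_m)) by rewrite val_enum_ord iota_ltn_sorted.
elim: (enum 'I_m) => [_|i s IHs] /=.
  by rewrite big_nil; congr gmonomial; apply/setP => i; rewrite !inE andbF.
rewrite (path_sortedE ltn_trans) => /andP [/allP lt_is /IHs {IHs} IHs].
have nis : i \notin s.
  by apply/negP => /(map_f val) /lt_is; rewrite /= ltnn.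
rewrite big_cons -IHs; case: (boolP (i \in A)) => iA; last first.
  rewrite mul1r; congr gmonomial; apply/setP => j; rewrite !inE.
  by case: eqP => // ->; rewrite (negPf iA).
rewrite /xi expr1 gmonomialM; last by rewrite disjoints1 !inE (negPf nis) andbF.
rewrite /inversions big_set1 big1 ?scale1r.
  by congr gmonomial; apply/setP => j; rewrite !inE; case: eqP => // ->;
    rewrite iA.
move=> j; rewrite !inE => /andP [_ /(map_f val) /lt_is] /= lt_ij.
by rewrite ltnNge ltnW.
Qed.

Lemma grassmann_expand a : a = \sum_A gcoef A a *: gmonomial A.
Proof.
apply: grassmannP => S; rewrite gcoef_sum (bigD1 S) //= big1 ?addr0.
  by rewrite gcoefZ gcoef_gmonomial eqxx mulr1.
by move=> A /negPf nA; rewrite gcoefZ gcoef_gmonomial eq_sym nA mulr0.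
Qed.

Definition ghomog (d : nat) a : Prop :=
  forall A, #|A| != d -> gcoef A a = 0.

Lemma ghomogM d d' a b : ghomog d a -> ghomog d' b -> ghomog (d + d') (a * b).
Proof.
move=> ha hb S; rewrite gcoefM => dS; apply: big1 => A AS.
have [dA|/ha ->] := eqVneq #|A| d; last by rewrite mulr0 mul0r.
have [dD|/hb ->] := eqVneq #|S :\: A| d'; last by rewrite mulr0.
by move: dS; rewrite -(cardsID A S) (setIidPr AS) dA dD eqxx.
Qed.

Lemma ghomog1 : ghomog 0 1.
Proof. by move=> A; rewrite cards_eq0 gcoef_gmonomial; case: eqP. Qed.

Lemma ghomog_xi_sum (f : 'I_m -> K) : ghomog 1 (\sum_j f j *: xi j).
Proof.
move=> A dA; rewrite gcoef_sum big1 // => j _; rewrite gcoefZ gcoef_gmonomial.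
case: eqP => [Aj|_]; last by rewrite mulr0.
by rewrite Aj cards1 in dA.
Qed.

Lemma ghomog_prod I (r : seq I) (e : I -> nat) (F : I -> grassmann K m) :
  (forall i, ghomog 1 (F i)) ->
  ghomog (\sum_(i <- r) e i) (\prod_(i <- r) F i ^+ e i).
Proof.
move=> hF; elim: r => [|i r IHr]; first by rewrite !big_nil; apply: ghomog1.
rewrite !big_cons; apply: ghomogM => //.
elim: (e i) => [|k IHk]; first exact: ghomog1.
by rewrite exprS -add1n; apply: ghomogM.
Qed.

End Grassmann.

Arguments xi {K m} i.
Arguments gmonomial {K m} A.

Section Krawtchouk.
Variable n : nat.
Implicit Types e et : 'rV[int]_n.+1.

(* Exponents are integer vectors, so that e + e_k - e_l makes sense. *)
Definition is_Z2 e : bool := [forall i, (e 0 i == 0) || (e 0 i == 1)].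

Definition weight e : int := \sum_(i < n.+1) e 0 i.

Definition psum (j : 'I_n.+1) e : int := \sum_(k < n.+1 | (k < j)%N) e 0 k.

Definition supp_set e : {set 'I_n.+1} := [set i | e 0 i != 0].

(* With d = |et|, the coefficient of xi^e in the product
   \prod_i (\sum_j v_ij xi_j)^(et_i) is d! times the odd Krawtchouk polynomial;
   the latter is extended by 0 to all integer vectors. *)
Definition odd_krawtchouk (K : fieldType) (V : 'M[K]_n.+1) e et : K :=
  if is_Z2 e && is_Z2 et then
    gcoef (supp_set e)
      (\prod_(i < n.+1) (\sum_(j < n.+1) V i j *: xi j) ^+ absz (et 0 i))
    / ((absz (weight et))`!)%:R
  else 0.

Definition indicator_row (A : {set 'I_n.+1}) : 'rV[int]_n.+1 :=
  \row_i (i \in A)%:R.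

Lemma is_Z2_indicator_row A : is_Z2 (indicator_row A).
Proof. by apply/forallP => i; rewrite mxE; case: (i \in A). Qed.

Lemma supp_set_indicator_row A : supp_set (indicator_row A) = A.
Proof. by apply/setP => i; rewrite inE mxE; case: (i \in A). Qed.

Lemma indicator_row_supp_set e : is_Z2 e -> indicator_row (supp_set e) = e.
Proof.
move/forallP => he; apply/rowP => i; rewrite mxE inE.
by case/orP: (he i) => /eqP ->.
Qed.

Lemma absz_weight e : is_Z2 e ->
  absz (weight e) = (\sum_(i < n.+1) absz (e 0%R i))%N.
Proof.
move/forallP => he; rewrite /weight.
have -> : \sum_(i < n.+1) e 0 i = (\sum_(i < n.+1) absz (e 0%R i))%N%:Z.
  rewrite (big_morph Posz PoszD (erefl 0%:Z)); apply: eq_bigr => i _.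
  by case/orP: (he i) => /eqP ->.
by [].
Qed.

(* The generating function: the vectors of weight d in {0,1}^(n+1) are the
   indicator_row A for #|A| = d. *)
Lemma odd_krawtchouk_gen (K : numFieldType) (V : 'M[K]_n.+1) et (d : nat) :
  is_Z2 et -> weight et = d ->
  \prod_(i < n.+1) (\sum_(j < n.+1) V i j *: xi j) ^+ absz (et 0 i) =
  \sum_(A : {set 'I_n.+1} | #|A| == d)
    (d`!%:R * odd_krawtchouk V (indicator_row A) et)
      *: \prod_(i < n.+1) xi i ^+ (i \in A).
Proof.
move=> het wet; set p := \prod_i _.
have hp : ghomog d p.
  have <- : absz (weight et) = d by rewrite wet.
  rewrite (absz_weight het); apply: ghomog_prod => i.
  exact: ghomog_xi_sum.
rewrite {1}(grassmann_expand p) (bigID (fun A : {set _} => #|A| == d)) /=.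
rewrite [X in _ + X]big1 ?addr0 => [|A /hp ->]; last by rewrite scale0r.
apply: eq_bigr => A _; rewrite -gmonomialE; congr (_ *: _).
rewrite /odd_krawtchouk is_Z2_indicator_row het supp_set_indicator_row wet /=.
by rewrite mulrC divfK // pnatr_eq0 -lt0n fact_gt0.
Qed.

End Krawtchouk.

(* Main.v *)
Require Import Defs.
From HB Require Import structures.
From mathcomp Require Import all_boot all_order all_algebra.
From mathcomp Require Import ring.
From mathcomp Require Import reals complex.

Set Implicit Arguments.
Unset Strict Implicit.
Unset Printing Implicit Defensive.

Import Order.TTheory GRing.Theory Num.Theory.
Local Open Scope ring_scope.

(** Let [w_i = \sum_j v_ij xi_j] be the linear form of the i-th row of [V], and
[w^et] their ordered product, so that [P e et] is the coefficient of [xi^e] in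
[w^et] divided by [d!].  Both recurrences come from evaluating a number
operator, of the form multiplication by a linear form after contraction with a
vector, in the two coordinate systems [xi] and [w].

The operator [xi_i d/dxi_i] multiplies [xi^e] by [e_i], which gives the left-hand
side of the first recurrence.  The hypothesis on [V], with its factors [Q V] and
[Qt V^T] exchanged, says that [V] is invertible and [xi_i = \sum_k c_k w_k], where
[c_k = q_0^-1 qt_i q_k v_ki], and the chain rule gives [d/dxi_i = \sum_l v_li d/dw_l].  The operator is therefore
[\sum_(k, l) c_k v_li w_k d/dw_l], and [w_k d/dw_l] sends [w^et] to
[w^(et + e_k - e_l)] up to the sign of the recurrence, or to 0.  This is
[minor_rec_rows].

For the second recurrence, put [c_k = q_0^-1 q_i qt_k v_ik] and contract with
[\sum_k c_k d/dxi_k].  The hypothesis on [V] says that this derivation is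
[d/dw_i]; after multiplication by [w_i] it is the number operator of [w_i], which multiplies [w^et] by [et_i].  Expanding
[w_i] and the derivation in the coordinates [xi] and reading off the coefficient
of [xi^e] moves [e] instead of [et].  This is [minor_rec_cols].

What these arguments need is the chain rule for contractions of ordered products
([contraction_ordered_prod]), a consequence of the super-Leibniz rule
([contraction_linear_formM]), and the sign with which a factor is absorbed by an
ordered product ([mul_ordered_prod]).  The moves [e + e_k - e_l] preserve the
degree, so the factor [d!] is common to all terms; a move that leaves [{0, 1}^(n+1)]
corresponds to a vanishing product.  The last two relations are the case [i = 0],
with the terms [k = l] taken out of the double sum. *)

(** * Signs *)

Section Signs.
Variables (K : comNzRingType) (m : nat).
Implicit Types (i j : 'I_m) (S : {set 'I_m}).

(** The sign [(-1)^(s_i)]: the cost of moving an odd factor of index [i] to its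
place inside an increasing product indexed by [S]. *)
Definition pass_sign i S : K := (-1) ^+ inversions [set i] S.

Lemma pass_signK i S : pass_sign i S * pass_sign i S = 1.
Proof. by rewrite -expr2 sqrr_sign. Qed.

Lemma pass_signU1 i j S : j \notin S ->
  pass_sign i (j |: S) = (-1) ^+ (j < i)%N * pass_sign i S.
Proof.
by move=> jS; rewrite /pass_sign inversionsUr ?disjoints1 // inversions11 exprD.
Qed.

Lemma pass_signD1 i S : pass_sign i (S :\ i) = pass_sign i S.
Proof.
case: (boolP (i \in S)) => iS.
  by rewrite -{2}(setD1K iS) pass_signU1 ?setD11 // ltnn mul1r.
by congr pass_sign; apply/setDidPl; rewrite disjoint_sym disjoints1.
Qed.

(** Inserting [i] and [j] in either order differs by a transposition: exactly one
of [i < j], [j < i] holds, and it contributes the minus sign. *)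
Lemma pass_signC i j S : i != j -> i \notin S -> j \notin S ->
  pass_sign i (j |: S) * pass_sign j (i |: S) = - (pass_sign i S * pass_sign j S).
Proof.
move=> ij iS jS; rewrite !pass_signU1 //.
by case: ltngtP ij => [||/val_inj ->]; rewrite ?eqxx //= => _ _; ring.
Qed.

End Signs.

Arguments pass_sign {K m} i S.

(** * Ordered products of anticommuting elements *)

Section OrderedProduct.
Variables (K : comNzRingType) (m : nat) (x : 'I_m -> grassmann K m).
Hypothesis x_anticomm : forall i j, x i * x j = - (x j * x i).
Hypothesis x_sqr0 : forall i, x i * x i = 0.

Definition ordered_prod (A : {set 'I_m}) : grassmann K m :=
  \prod_(i < m) x i ^+ (i \in A).

Lemma ordered_prod0 : ordered_prod set0 = 1.
Proof. by rewrite /ordered_prod big1 // => i _; rewrite inE. Qed.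

(** The new factor is moved past the factors of smaller index, one sign for each;
if [x i] already occurs, it meets its copy and the square vanishes.  The
induction is on the increasing list of indices. *)
Lemma mul_ordered_prod i A : x i * ordered_prod A =
  if i \in A then 0 else pass_sign i A *: ordered_prod (i |: A).
Proof.
pose s := enum 'I_m.
have srt_s : sorted ltn (map val s) by rewrite val_enum_ord iota_ltn_sorted.
have is_ : i \in s by rewrite mem_enum.
have opE B : ordered_prod B = \prod_(j <- s) x j ^+ (j \in B).
  by rewrite /ordered_prod /s enumT.
have -> : pass_sign i A = (-1) ^+ (\sum_(j <- s) (j \in A) && (j < i))%N :> K.
  rewrite /pass_sign /inversions big_set1 /s big_enum /= [in LHS]big_mkcond /=.
  by congr (_ ^+ _); apply: eq_bigr => j _; case: (j \in A).
rewrite !opE; elim: s srt_s is_ {opE} => // h s IHs /=.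
rewrite (path_sortedE ltn_trans) => /andP [/allP lt_hs srt_s].
have hs : h \notin s by apply/negP => /(map_f val) /lt_hs; rewrite /= ltnn.
rewrite in_cons !big_cons in_setU1; case: eqVneq => [->|neq_ih] /= is_.
  (* The place of the new factor is reached: all the remaining indices are
     larger, so they contribute no sign. *)
  case: (boolP (h \in A)) => hA.
    by rewrite expr1 mulrA x_sqr0 mul0r.
  have -> : (\sum_(j <- s) (j \in A) && (j < h) = 0)%N.
    apply: big1_seq => j /= js.
    by rewrite (ltnNge j) (ltnW (lt_hs _ (map_f val js))) andbF.
  rewrite expr0 mul1r addn0 expr0 scale1r; congr (_ * _); apply: eq_big_seq => j js.
  by rewrite in_setU1; case: eqVneq => // jh; rewrite -jh js in hs.
have lt_hi : (h < i)%N by apply: lt_hs; apply: map_f.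
rewrite lt_hi andbT /=.
have xih : x i * x h ^+ (h \in A) = (-1) ^+ (h \in A) *: (x h ^+ (h \in A) * x i).
  case: (h \in A); last by rewrite !expr0 mulr1 mul1r scale1r.
  by rewrite !expr1 x_anticomm scaleN1r.
rewrite mulrA xih -scalerAl -mulrA IHs //.
case: (i \in A); first by rewrite mulr0 scaler0.
by rewrite -scalerAr scalerA exprD.
Qed.

Lemma ordered_prodD1 i (A : {set 'I_m}) : i \in A ->
  ordered_prod A = pass_sign i (A :\ i) *: (x i * ordered_prod (A :\ i)).
Proof.
move=> iA; rewrite mul_ordered_prod setD11 setD1K // scalerA.
by rewrite pass_signK scale1r.
Qed.

End OrderedProduct.

(** * Linear forms and partial derivatives *)

Section Derivative.
Variables (K : comNzRingType) (m : nat).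
Implicit Types (i j k l : 'I_m) (S A : {set 'I_m}) (f g : grassmann K m).
Implicit Types (a b : 'I_m -> K).

Definition linear_form b : grassmann K m := \sum_j b j *: xi j.

Lemma linear_form_anticomm a b :
  linear_form a * linear_form b = - (linear_form b * linear_form a).
Proof.
rewrite /linear_form !mulr_suml; under eq_bigr do rewrite mulr_sumr.
under [in RHS]eq_bigr do rewrite mulr_sumr.
rewrite exchange_big -sumrN; apply: eq_bigr => j _.
rewrite -sumrN; apply: eq_bigr => i _.
by rewrite -!scalerAl -!scalerAr xi_anticomm !scalerN !scalerA mulrC.
Qed.

(** Anticommutation gives only twice this statement, so the square is expanded:
the diagonal terms vanish and the mixed ones cancel in pairs. *)
Lemma linear_form_sqr0 b : linear_form b * linear_form b = 0.
Proof.
rewrite /linear_form; elim: (index_enum _) => [|j r IHr].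
  by rewrite big_nil mul0r.
rewrite big_cons mulrDl !mulrDr IHr addr0.
rewrite -{1}scalerAl -{1}scalerAr -expr2 xi_sqr0 !scaler0 add0r.
rewrite mulr_sumr mulr_suml -big_split big1 //= => i _.
rewrite -!scalerAl -!scalerAr xi_anticomm !scalerN !scalerA.
by rewrite mulrC addNr.
Qed.

Lemma gcoef_xiM j S f : gcoef S (xi j * f) =
  if j \in S then pass_sign j (S :\ j) * gcoef (S :\ j) f else 0.
Proof.
rewrite gcoefM; case: ifP => jS.
  rewrite (bigD1 [set j]) ?sub1set //= gcoef_gmonomial eqxx mulr1 big1 ?addr0 //.
  by move=> A /andP [_ /negPf nA]; rewrite gcoef_gmonomial nA mulr0 mul0r.
apply: big1 => A AS; rewrite gcoef_gmonomial.
case: eqP => [eA|]; last by rewrite mulr0 mul0r.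
by rewrite eA sub1set jS in AS.
Qed.

(** The left partial derivative, by its coefficients: since [xi_(k |: S)] is
[pass_sign k S] times [xi_k * xi_S], the coefficient of [xi_(k |: S)] contributes
to the one of [xi_S]. *)
Definition gderiv k f : grassmann K m :=
  [ffun S : {set 'I_m} =>
     if k \in S then 0 else pass_sign k S * gcoef (k |: S) f].

Lemma gcoef_gderiv k S f : gcoef S (gderiv k f) =
  if k \in S then 0 else pass_sign k S * gcoef (k |: S) f.
Proof. by rewrite {1}/gcoef ffunE. Qed.

Lemma gderiv_is_linear k : linear (gderiv k).
Proof.
move=> c f g; apply: grassmannP => S; rewrite gcoefD gcoefZ !gcoef_gderiv.
by case: ifP => _; rewrite ?gcoefD ?gcoefZ; ring.
Qed.

HB.instance Definition _ k :=
  GRing.isLinear.Build K (grassmann K m) (grassmann K m) *:%R (gderiv k)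
    (gderiv_is_linear k).

Lemma gderiv1 k : gderiv k 1 = 0.
Proof.
apply: grassmannP => S; rewrite gcoef_gderiv gcoef0 gcoef_gmonomial.
case: ifP => // _; rewrite [_ == set0](_ : _ = false) ?mulr0 //.
by apply/negbTE/set0Pn; exists k; rewrite setU11.
Qed.

(** The canonical anticommutation relation between [d/dxi_k] and [xi_j]. *)
Lemma gderiv_xiM k j f : gderiv k (xi j * f) = (k == j)%:R *: f - xi j * gderiv k f.
Proof.
apply: grassmannP => S; rewrite gcoefD -scaleN1r !gcoefZ gcoef_xiM !gcoef_gderiv.
rewrite gcoef_xiM !inE; have [->|kj] := eqVneq k j.
  case: (boolP (j \in S)) => jS.
    by rewrite setD1K // (mulrA (pass_sign _ _)) pass_signK mulr1n; ring.
  by rewrite setU1K // mulrA pass_signK mulr1n; ring.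
rewrite /= mulr0n mul0r add0r.
case: (boolP (j \in S)) => jS; case: (boolP (k \in S)) => kS //;
  rewrite /= ?mulr0 //.
have -> : (k |: S) :\ j = k |: S :\ j.
  by apply/setP => i; rewrite !inE; case: (eqVneq i k) => // ->; rewrite kj.
rewrite -{1}(setD1K jS) !mulrA.
by rewrite pass_signC ?setD11 // ?inE ?(negPf kS) ?andbF //; ring.
Qed.

(** The interior product with the vector [a], an odd derivation. *)
Definition contraction a f : grassmann K m := \sum_k a k *: gderiv k f.

Lemma contraction1 a : contraction a 1 = 0.
Proof. by rewrite /contraction big1 // => k _; rewrite gderiv1 scaler0. Qed.

Lemma contractionZ a c f : contraction a (c *: f) = c *: contraction a f.
Proof.
rewrite /contraction scaler_sumr; apply: eq_bigr => k _.
by rewrite linearZ /= !scalerA mulrC.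
Qed.

(** The super-Leibniz rule for a left factor of degree one; the scalar is the
pairing of the vector [a] with the form [b]. *)
Lemma contraction_linear_formM a b f : contraction a (linear_form b * f) =
  (\sum_k a k * b k) *: f - linear_form b * contraction a f.
Proof.
rewrite /contraction mulr_sumr scaler_suml -sumrB; apply: eq_bigr => k _.
rewrite /linear_form !mulr_suml linear_sum /= scaler_sumr.
rewrite (eq_bigr (fun j => (a k * b j * (k == j)%:R) *: f
    - b j *: xi j * (a k *: gderiv k f))).
  rewrite sumrB (bigD1 k) //= eqxx mulr1 big1 ?addr0 // => j /negPf jk.
  by rewrite eq_sym jk mulr0 scale0r.
move=> j _; rewrite -scalerAl linearZ /= gderiv_xiM.
by rewrite -scalerAl -scalerAr !scalerBr !scalerA [b j * a k]mulrC.
Qed.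

(** The operator [xi_l d/dxi_k] is the transpose of [xi_k d/dxi_l] with respect to
the monomials, hence on coefficients [l] is removed from [S] and [k] inserted. *)
Lemma gcoef_xi_gderiv l k S f : gcoef S (xi l * gderiv k f) =
  pass_sign k (S :\ l) * pass_sign l S * (l \in S)%:R
    * (if k \in S :\ l then 0 else gcoef (k |: S :\ l) f).
Proof.
rewrite gcoef_xiM gcoef_gderiv pass_signD1.
by case: (l \in S); case: (k \in S :\ l); rewrite /=; ring.
Qed.

(** The chain rule.  Any factor can be brought to the front at the cost of a sign,
so the induction may remove an arbitrary [h] of [A]: the Leibniz rule produces
the term [l = h], and the terms of the induction hypothesis get [h] back with the
sign given by [pass_signC]. *)
Lemma contraction_ordered_prod a (b : 'I_m -> 'I_m -> K) A :
  contraction a (ordered_prod (fun i => linear_form (b i)) A) =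
  \sum_(l in A) (pass_sign l A * \sum_k a k * b l k)
     *: ordered_prod (fun i => linear_form (b i)) (A :\ l).
Proof.
set x := fun i => linear_form (b i).
have xC i j : x i * x j = - (x j * x i) by apply: linear_form_anticomm.
have xx i : x i * x i = 0 by apply: linear_form_sqr0.
have [d] := ubnP #|A|; elim: d A => // d IHd A.
have [->|/set0Pn [h hA]] := eqVneq A set0.
  by rewrite ordered_prod0 contraction1 big_set0.
rewrite (cardsD1 h) hA ltnS => /IHd {}IHd.
rewrite (ordered_prodD1 xC xx hA) contractionZ.
rewrite contraction_linear_formM IHd.
rewrite scalerBr scalerA pass_signD1 [in RHS](bigD1 h) //=; congr (_ + _).
rewrite -/(x h) mulr_sumr scaler_sumr -sumrN.
rewrite [in RHS](eq_bigl (fun l => l \in A :\ h)); last first.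
  by move=> l; rewrite !inE andbC.
apply: eq_bigr => l; rewrite !inE => /andP [lh lA].
set B := A :\ h :\ l.
have AhE : A :\ h = l |: B by rewrite setD1K // !inE lh.
have AlE : A :\ l = h |: B.
  by apply/setP => i; rewrite !inE; case: (eqVneq i h) => // ->; rewrite eq_sym lh hA.
have hB : h \notin B by rewrite !inE eqxx andbF.
have lB : l \notin B by rewrite !inE eqxx.
rewrite -scalerAr mul_ordered_prod // (negPf hB) -AlE !scalerA -scaleNr.
congr (_ *: _).
rewrite -(pass_signD1 _ h A) -(pass_signD1 _ l A) -(pass_signD1 _ l (A :\ h)).
rewrite -/B AhE AlE.
have := pass_signC K lh lB hB.
have := pass_signK K h (l |: B).
set s1 := pass_sign l (_ |: _); set s2 := pass_sign h (_ |: _).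
set s3 := pass_sign h B; set s4 := pass_sign l B => s22 E.
have -> : s1 = - (s4 * s3) * s2 by rewrite -E -mulrA s22 mulr1.
by ring.
Qed.

End Derivative.

(** * Recurrences for the coefficients *)

Section Recurrences.
Variables (K : fieldType) (n : nat) (V : 'M[K]_n.+1).
Implicit Types (A B : {set 'I_n.+1}).

Definition row_form i : grassmann K n.+1 := linear_form (V i).

(** For [#|A| = #|B|] this is the determinant of the submatrix of [V] with rows [A]
and columns [B]. *)
Definition minor A B : K := gcoef B (ordered_prod row_form A).

Lemma mul_row_form k A : row_form k * ordered_prod row_form A =
  if k \in A then 0 else pass_sign k A *: ordered_prod row_form (k |: A).
Proof.
by apply: mul_ordered_prod => *; [apply: linear_form_anticomm|apply: linear_form_sqr0].
Qed.

(** The hypothesis says that [c] is row [i] of the inverse of [V], that is,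
[xi i = \sum_k c k *: row_form k].  Both sides are the coefficient on [B] of
[xi i * gderiv i f], with [f] the ordered product over [A]: on the left computed
in the [xi], on the right in the [row_form]. *)
Lemma minor_rec_rows A B i (c : 'I_n.+1 -> K) :
    (forall j, \sum_k c k * V k j = (j == i)%:R) ->
  (i \in B)%:R * minor A B = \sum_k \sum_l c k * V l i
    * (pass_sign k (A :\ l) * pass_sign l A * (l \in A)%:R
       * (if k \in A :\ l then 0 else minor (k |: A :\ l) B)).
Proof.
move=> cV; set f := ordered_prod row_form A.
have xiE : xi i = \sum_k c k *: row_form k.
  rewrite /row_form /linear_form; under eq_bigr do rewrite scaler_sumr.
  rewrite exchange_big (bigD1 i) //= [X in _ + X]big1 ?addr0 => [|j /negPf ji].
    by under eq_bigr do rewrite scalerA; rewrite -scaler_suml cV eqxx scale1r.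
  by under eq_bigr do rewrite scalerA; rewrite -scaler_suml cV ji scale0r.
have dE : gderiv i f = \sum_(l in A) (pass_sign l A * V l i)
     *: ordered_prod row_form (A :\ l).
  have <- : contraction (fun k => (k == i)%:R) f = gderiv i f.
    rewrite /contraction (bigD1 i) //= eqxx scale1r big1 ?addr0 // => k /negPf ->.
    by rewrite scale0r.
  rewrite contraction_ordered_prod; apply: eq_bigr => l _; congr ((_ * _) *: _).
  by rewrite (bigD1 i) //= eqxx mul1r big1 ?addr0 // => k /negPf ->; rewrite mul0r.
transitivity (gcoef B (xi i * gderiv i f)).
  rewrite gcoef_xi_gderiv pass_signD1 pass_signK mul1r setD11.
  by case: (boolP (i \in B)) => iB; rewrite ?mul0r // setD1K.
rewrite {1}xiE dE mulr_suml gcoef_sum; apply: eq_bigr => k _.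
rewrite mulr_sumr gcoef_sum [in LHS]big_mkcond; apply: eq_bigr => l _ /=.
case: (l \in A); last by rewrite mulr0 mul0r mulr0.
rewrite -scalerAl -scalerAr !gcoefZ mul_row_form.
by case: ifP => _; rewrite mulr1n ?gcoef0 ?gcoefZ /minor; ring.
Qed.

(** The hypothesis says that contraction with [c] is dual to the forms
[row_form j], picking out [row_form i]; so multiplying the contraction by
[row_form i] counts the occurrences of that factor in the ordered product over
[A].  The right-hand side is the expansion of the same operator in the [xi]. *)
Lemma minor_rec_cols A B i (c : 'I_n.+1 -> K) :
    (forall j, \sum_k c k * V j k = (j == i)%:R) ->
  (i \in A)%:R * minor A B = \sum_k \sum_l c k * V i l
    * (pass_sign k (B :\ l) * pass_sign l B * (l \in B)%:R
       * (if k \in B :\ l then 0 else minor A (k |: B :\ l))).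
Proof.
move=> cV; set f := ordered_prod row_form A.
transitivity (gcoef B (row_form i * contraction c f)).
  have -> : row_form i * contraction c f = (i \in A)%:R *: f.
    rewrite contraction_ordered_prod; case: (boolP (i \in A)) => iA; last first.
      rewrite scale0r big1 ?mulr0 // => l lA; rewrite cV.
      by case: eqVneq => [li|_]; [rewrite -li lA in iA | rewrite mulr0 scale0r].
    rewrite (bigD1 i) //= [X in _ + X]big1 => [|l /andP [_ /negPf li]]; last first.
      by rewrite cV li mulr0 scale0r.
    rewrite addr0 cV eqxx mulr1 -scalerAr mul_row_form setD11 setD1K //.
    by rewrite scalerA pass_signD1 pass_signK.
  by rewrite gcoefZ.
rewrite /contraction mulr_sumr gcoef_sum; apply: eq_bigr => k _.
rewrite mulr_suml gcoef_sum; apply: eq_bigr => l _.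
by rewrite -scalerAl -scalerAr !gcoefZ gcoef_xi_gderiv mulrCA mulrA.
Qed.

(** * From coefficients to odd Krawtchouk polynomials *)

Lemma odd_krawtchouk_indicator A B :
  odd_krawtchouk V (indicator_row B) (indicator_row A) = minor A B / (#|A|`!)%:R.
Proof.
rewrite /odd_krawtchouk !is_Z2_indicator_row supp_set_indicator_row /=.
congr (gcoef _ _ / (_`!)%:R).
  apply: eq_bigr => i _; rewrite mxE; congr (_ ^+ _).
  by case: (i \in A).
rewrite absz_weight ?is_Z2_indicator_row // -sum1_card [in RHS]big_mkcond /=.
by apply: eq_bigr => i _; rewrite mxE; case: (i \in A).
Qed.

Lemma psum_indicator_row k A :
  psum k (indicator_row A) = (inversions [set k] A)%:Z.
Proof.
rewrite /psum /inversions big_set1 (big_morph Posz PoszD (erefl 0%:Z)).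
rewrite [in LHS]big_mkcond [in RHS]big_mkcond /=; apply: eq_bigr => i _.
by rewrite mxE; case: (i \in A); case: (i < k)%N.
Qed.

Lemma indicator_rowD1 l A : l \in A ->
  indicator_row A - delta_mx 0 l = indicator_row (A :\ l).
Proof.
move=> lA; apply/rowP => i; rewrite !mxE !inE /=.
by case: eqVneq => [->|_]; rewrite ?lA ?subrr ?subr0.
Qed.

Lemma indicator_rowU1 k A : k \notin A ->
  indicator_row A + delta_mx 0 k = indicator_row (k |: A).
Proof.
move=> kA; apply/rowP => i; rewrite !mxE !inE /=.
by case: eqVneq => [->|_]; rewrite ?(negPf kA) ?add0r ?addr0.
Qed.

Lemma indicator_row_move k l A : l \in A ->
  indicator_row A + delta_mx 0 k - delta_mx 0 l
  = indicator_row (A :\ l) + delta_mx 0 k.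
Proof. by move=> lA; rewrite addrAC indicator_rowD1. Qed.

Lemma not_Z2_indicator_rowD k A : k \in A ->
  is_Z2 (indicator_row A + delta_mx 0 k) = false.
Proof.
by move=> kA; apply/negbTE/forallPn; exists k; rewrite !mxE kA !eqxx.
Qed.

Lemma sign_psum k l A : l \in A ->
  (-1) ^ (psum k (indicator_row A - delta_mx 0 l) + psum l (indicator_row A))
  = pass_sign k (A :\ l) * pass_sign l A :> K.
Proof.
by move=> lA; rewrite indicator_rowD1 // !psum_indicator_row -PoszD -exprnP exprD.
Qed.

(** Translation of one term of the recurrence.  The weight survives the move, so
the factorial is the one of [A]; when [k] already lies in [A :\ l] the moved vector
has an entry 2 and the polynomial is 0 by convention, as is the product of the
forms. *)
Lemma krawtchouk_move_rows k l A B :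
  (-1) ^ (psum k (indicator_row A - delta_mx 0 l) + psum l (indicator_row A))
    * (indicator_row A 0 l)%:~R
    * odd_krawtchouk V (indicator_row B) (indicator_row A + delta_mx 0 k - delta_mx 0 l)
  = (pass_sign k (A :\ l) * pass_sign l A * (l \in A)%:R
       * (if k \in A :\ l then 0 else minor (k |: A :\ l) B)) / (#|A|`!)%:R.
Proof.
rewrite [indicator_row A 0 l]mxE; case: (boolP (l \in A)) => lA; last first.
  by rewrite !(mulr0, mul0r).
rewrite sign_psum // indicator_row_move //; case: ifP => kA.
  by rewrite /odd_krawtchouk not_Z2_indicator_rowD // andbF !(mulr0, mul0r).
rewrite indicator_rowU1 ?kA // odd_krawtchouk_indicator.
by rewrite cardsU1 kA [in RHS](cardsD1 l) lA /=; ring.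
Qed.

Lemma krawtchouk_move_cols k l A B :
  (-1) ^ (psum k (indicator_row B - delta_mx 0 l) + psum l (indicator_row B))
    * (indicator_row B 0 l)%:~R
    * odd_krawtchouk V (indicator_row B + delta_mx 0 k - delta_mx 0 l) (indicator_row A)
  = (pass_sign k (B :\ l) * pass_sign l B * (l \in B)%:R
       * (if k \in B :\ l then 0 else minor A (k |: B :\ l))) / (#|A|`!)%:R.
Proof.
rewrite [indicator_row B 0 l]mxE; case: (boolP (l \in B)) => lB; last first.
  by rewrite !(mulr0, mul0r).
rewrite sign_psum // indicator_row_move //; case: ifP => kB.
  by rewrite /odd_krawtchouk not_Z2_indicator_rowD // !(mulr0, mul0r).
by rewrite indicator_rowU1 ?kB // odd_krawtchouk_indicator /=; ring.
Qed.

Lemma krawtchouk_rec_rows e et i (c : 'I_n.+1 -> K) :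
    is_Z2 e -> is_Z2 et -> (forall j, \sum_k c k * V k j = (j == i)%:R) ->
  (e 0 i)%:~R * odd_krawtchouk V e et = \sum_k \sum_l
    c k * V l i * (-1) ^ (psum k (et - delta_mx 0 l) + psum l et)
      * (et 0 l)%:~R * odd_krawtchouk V e (et + delta_mx 0 k - delta_mx 0 l).
Proof.
move=> /indicator_row_supp_set <- /indicator_row_supp_set <-.
move: (supp_set e) (supp_set et) => B A cV.
transitivity ((i \in B)%:R * minor A B / (#|A|`!)%:R).
  by rewrite odd_krawtchouk_indicator mxE mulrA; case: (i \in B).
rewrite (minor_rec_rows _ _ cV) mulr_suml; apply: eq_bigr => k _.
rewrite mulr_suml; apply: eq_bigr => l _.
by rewrite -!mulrA; do 2!congr (_ * _); rewrite !mulrA krawtchouk_move_rows.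
Qed.

Lemma krawtchouk_rec_cols e et i (c : 'I_n.+1 -> K) :
    is_Z2 e -> is_Z2 et -> (forall j, \sum_k c k * V j k = (j == i)%:R) ->
  (et 0 i)%:~R * odd_krawtchouk V e et = \sum_k \sum_l
    c k * V i l * (-1) ^ (psum k (e - delta_mx 0 l) + psum l e)
      * (e 0 l)%:~R * odd_krawtchouk V (e + delta_mx 0 k - delta_mx 0 l) et.
Proof.
move=> /indicator_row_supp_set <- /indicator_row_supp_set <-.
move: (supp_set e) (supp_set et) => B A cV.
transitivity ((i \in A)%:R * minor A B / (#|A|`!)%:R).
  by rewrite odd_krawtchouk_indicator mxE mulrA; case: (i \in A).
rewrite (minor_rec_cols _ _ cV) mulr_suml; apply: eq_bigr => k _.
rewrite mulr_suml; apply: eq_bigr => l _.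
by rewrite -!mulrA; do 2!congr (_ * _); rewrite !mulrA krawtchouk_move_cols.
Qed.

(** For [k = l] the vector does not move, and both exponents are [psum k x] because
[psum k] does not see the entry [k]; so the sign is [+1]. *)
Lemma split_diagonal (x : 'rV[int]_n.+1) (c : 'I_n.+1 -> K) (p : 'rV[int]_n.+1 -> K) :
  \sum_k \sum_l c k * (-1) ^ (psum k (x - delta_mx 0 l) + psum l x)
    * (x 0 l)%:~R * p (x + delta_mx 0 k - delta_mx 0 l)
  = \sum_k c k * (x 0 k)%:~R * p x
    + \sum_k \sum_(l | l != k) c k
        * (-1) ^ (psum k (x - delta_mx 0 l) + psum l x)
        * (x 0 l)%:~R * p (x + delta_mx 0 k - delta_mx 0 l).
Proof.
rewrite -big_split; apply: eq_bigr => k _; rewrite (bigD1 k) //=; congr (_ + _).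
have -> : psum k (x - delta_mx 0 k) = psum k x.
  by apply: eq_bigr => i ik; rewrite !mxE [i == k]ltn_eqF // subr0.
by rewrite addrK expfzDr ?oppr_eq0 ?oner_eq0 // -expfzMl mulrNN mulr1 exp1rz mulr1.
Qed.

(** The first family says that [q_0^-1 Qt V^T Q] is a left inverse of [V].  The
hypothesis gives a right inverse of [Q V], which is a left inverse because the
matrices are square; the second family is the hypothesis itself. *)
Lemma orthogonality (q qt : 'rV[K]_n.+1) : q 0 0 != 0 ->
    diag_mx q *m V *m diag_mx qt *m V^T = (q 0 0)%:M ->
  (forall i j, \sum_k (q 0 0)^-1 * qt 0 i * (q 0 k * V k i) * V k j = (j == i)%:R)
  /\ (forall i j, \sum_k (q 0 0)^-1 * q 0 i * (qt 0 k * V i k) * V j k = (j == i)%:R).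
Proof.
move=> q0 hV; set M := diag_mx q *m V; set N := (q 0 0)^-1 *: (diag_mx qt *m V^T).
have MN : M *m N = 1%:M.
  by rewrite -scalemxAr mulmxA hV scale_scalar_mx mulVf.
split=> i j.
  have /matrixP /(_ i j) := mulmx1C MN.
  rewrite !mxE eq_sym => <-; apply: eq_bigr => k _.
  by rewrite /M /N mul_diag_mx mxE mul_diag_mx !mxE; ring.
move/matrixP/(_ i j): MN; rewrite !mxE eq_sym => <-; apply: eq_bigr => k _.
by rewrite /M /N mul_diag_mx mxE mul_diag_mx !mxE; ring.
Qed.

End Recurrences.



Theorem proposition4p6 (R : realType) (n : nat)
    (q qt : 'rV[R[i]]_n.+1) (V : 'M[R[i]]_n.+1)
    (hq : q 0 0 = qt 0 0) (hq0 : q 0 0 != 0)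
    (hV0 : forall j : 'I_n.+1, V 0 j = 1)
    (hV1 : forall i : 'I_n.+1, V i 0 = 1)
    (hV : diag_mx q *m V *m diag_mx qt *m V^T = (q 0 0)%:M)
    (e et : 'rV[int]_n.+1) (he : is_Z2 e) (het : is_Z2 et)
    (hw : weight e = weight et) :
  let P := odd_krawtchouk V in
  let E (k : 'I_n.+1) : 'rV[int]_n.+1 := delta_mx 0 k in
  [/\ forall i : 'I_n.+1,
        (e 0 i)%:~R * P e et =
        (q 0 0)^-1 * qt 0 i *
        \sum_(k < n.+1) \sum_(l < n.+1)
          q 0 k * V k i * V l i
          * (-1) ^ (psum k (et - E l) + psum l et)
          * (et 0 l)%:~R * P e (et + E k - E l),
      forall i : 'I_n.+1,
        (et 0 i)%:~R * P e et =
        (q 0 0)^-1 * q 0 i *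
        \sum_(k < n.+1) \sum_(l < n.+1)
          qt 0 k * V i k * V i l
          * (-1) ^ (psum k (e - E l) + psum l e)
          * (e 0 l)%:~R * P (e + E k - E l) et,
      (e 0 0)%:~R * P e et =
        \sum_(k < n.+1) q 0 k * (et 0 k)%:~R * P e et
        + \sum_(k < n.+1) \sum_(l < n.+1 | l != k)
            q 0 k
            * (-1) ^ (psum k (et - E l) + psum l et)
            * (et 0 l)%:~R * P e (et + E k - E l)
    & (et 0 0)%:~R * P e et =
        \sum_(k < n.+1) qt 0 k * (e 0 k)%:~R * P e et
        + \sum_(k < n.+1) \sum_(l < n.+1 | l != k)
            qt 0 k
            * (-1) ^ (psum k (e - E l) + psum l e)
            * (e 0 l)%:~R * P (e + E k - E l) et].
Proof.
move=> P E; have [rowsV colsV] := orthogonality hq0 hV.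
have rec1 i : (e 0 i)%:~R * P e et =
    (q 0 0)^-1 * qt 0 i *
    \sum_(k < n.+1) \sum_(l < n.+1)
      q 0 k * V k i * V l i
      * (-1) ^ (psum k (et - E l) + psum l et)
      * (et 0 l)%:~R * P e (et + E k - E l).
  rewrite /P (krawtchouk_rec_rows he het (rowsV i)).
  rewrite mulr_sumr; apply: eq_bigr => k _; rewrite mulr_sumr.
  by apply: eq_bigr => l _; rewrite !mulrA.
have rec2 i : (et 0 i)%:~R * P e et =
    (q 0 0)^-1 * q 0 i *
    \sum_(k < n.+1) \sum_(l < n.+1)
      qt 0 k * V i k * V i l
      * (-1) ^ (psum k (e - E l) + psum l e)
      * (e 0 l)%:~R * P (e + E k - E l) et.
  rewrite /P (krawtchouk_rec_cols he het (colsV i)).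
  rewrite mulr_sumr; apply: eq_bigr => k _; rewrite mulr_sumr.
  by apply: eq_bigr => l _; rewrite !mulrA.
split=> //.
  rewrite rec1 -hq mulVf // mul1r -split_diagonal.
  by apply: eq_bigr => k _; apply: eq_bigr => l _; rewrite !hV1 !mulr1.
rewrite rec2 mulVf // mul1r -(split_diagonal _ _ (fun x => P x et)).
by apply: eq_bigr => k _; apply: eq_bigr => l _; rewrite !hV0 !mulr1.
Qed.
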